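(* Let the Euclidean plane $\mathbb{E}^2$ be coloured in red and blue (each point receives exactly one of the two colours) so that there are no two red points at distance $1$ apart. Then there exist five blue points that form an $\ell_5$.
   Context: For a positive integer $i$, $\ell_i$ denotes the configuration of $i$ collinear points with distance $1$ between consecutive points. A set of points in $\mathbb{E}^2$ forms an $\ell_i$ if it is congruent to this configuration, i.e. it equals $\{P, P+u, \dots, P+(i-1)u\}$ for some point $P$ and some unit vector $u$. *)

(* Defs.v *)
From Stdlib Require Import Reals.
Open Scope R_scope.

Definition point : Type := (R * R)%type.

Definition edist (A B : point) : R :=
  dist_euc (fst A) (snd A) (fst B) (snd B).

Definition unit_vector (u : point) : Prop := edist (0, 0) u = 1.

Definition translate (P : point) (t : R) (u : point) : point :=
  (fst P + t * fst u, snd P + t * snd u).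

Definition forms_ell (i : nat) (X : point -> Prop) : Prop :=
  exists P u : point,
    unit_vector u /\
    forall Q : point,
      X Q <-> exists k : nat, (k < i)%nat /\ Q = translate P (INR k) u.

Inductive colour : Set := red | blue.

(* Main.v *)
Require Import Defs.
From Stdlib Require Import Reals.
From Stdlib Require Import ZArith Lia Lra Classical.
Open Scope R_scope.

(** Suppose there is no blue [ell_5] and no red pair at distance 1.  Along any
    ray of unit steps leaving a red point one of the next five points is then
    red.  The proof shows that the first four of them are always blue:

    - distance 3 ([spaced_three]): two red points [A], [E] at distance 3 force
      the two points [B], [C] at distance [sqrt 3] from both to be red.  Turning
      the direction of [AE] by the angle of the Moser spindle gives unit lines
      near [B] and near [C] on which [A], [B], [C], [E] make four of five
      consecutive points blue.  The fifth points are red, and they are at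
      distance 1;

    - distance 2 ([lattice_two]) and then distance 4 ([lattice_four]): a short
      case analysis in one triangular lattice, where pairs at distance 3, and
      then also at distance 2, are already excluded.

    Hence a red point [P] makes [P + 5u] red for every unit vector [u]: the
    whole circle of radius 5 around [P] is red, and it has a chord of length 1. *)

(** * Unit vectors and rotations *)

(** Multiplication of [u] by the complex number [x + iy]. *)
Definition turn (x y : R) (u : point) : point :=
  (x * fst u - y * snd u, x * snd u + y * fst u).

Lemma unit_vector_sq (u : point) :
  unit_vector u <-> fst u * fst u + snd u * snd u = 1.
Proof.
unfold unit_vector, edist, dist_euc; simpl; unfold Rsqr.
replace ((0 - fst u) * (0 - fst u) + (0 - snd u) * (0 - snd u))
  with (fst u * fst u + snd u * snd u) by ring.
split; intros H.
- rewrite <- (sqrt_sqrt (fst u * fst u + snd u * snd u)) by nra.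
  rewrite H; ring.
- rewrite H; exact sqrt_1.
Qed.

Lemma unit_vector_turn (x y : R) (u : point) :
  x * x + y * y = 1 -> unit_vector u -> unit_vector (turn x y u).
Proof.
rewrite !unit_vector_sq; unfold turn; simpl; intros Hxy Hu.
transitivity ((x * x + y * y) * (fst u * fst u + snd u * snd u)); [ring|].
rewrite Hxy, Hu; ring.
Qed.

Lemma edist_translate (P u : point) :
  unit_vector u -> edist P (translate P 1 u) = 1.
Proof.
intros Hu; transitivity (edist (0, 0) u); [|exact Hu].
unfold edist, dist_euc, translate, Rsqr; simpl; f_equal; ring.
Qed.

(** * Triangular lattices *)

(** The squared length of [i + j w], with [w] a primitive sixth root of unity. *)
Definition eisenstein_norm (i j : Z) : Z := (i * i + i * j + j * j)%Z.

Definition sixth (u : point) : point := turn (1 / 2) (sqrt 3 / 2) u.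

Definition lattice_vector (u : point) (i j : Z) : point :=
  translate (translate (0, 0) (IZR i) u) (IZR j) (sixth u).

Definition lattice_point (P u : point) (i j : Z) : point :=
  translate (translate P (IZR i) u) (IZR j) (sixth u).

Lemma half_sqrt3_sq : (sqrt 3 / 2) * (sqrt 3 / 2) = 3 / 4.
Proof.
pose proof (sqrt_sqrt 3 ltac:(lra)) as H; lra.
Qed.

Lemma unit_lattice_vector (u : point) (a b : Z) :
  unit_vector u -> eisenstein_norm a b = 1%Z ->
  unit_vector (lattice_vector u a b).
Proof.
rewrite !unit_vector_sq; intros Hu Hab.
apply (f_equal IZR) in Hab; unfold eisenstein_norm in Hab.
rewrite !plus_IZR, !mult_IZR in Hab.
unfold lattice_vector, sixth, turn, translate; simpl.
pose proof half_sqrt3_sq as Hs; set (s := sqrt 3 / 2) in *.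
set (x := IZR a) in *; set (y := IZR b) in *.
transitivity ((x * x + x * y + y * y * (1 / 4) + y * y * (s * s))
  * (fst u * fst u + snd u * snd u)); [field|].
rewrite Hs, Hu.
replace (x * x + x * y + y * y * (1 / 4) + y * y * (3 / 4))
  with (x * x + x * y + y * y) by field.
rewrite Hab; ring.
Qed.

Lemma lattice_point_origin (P u : point) : lattice_point P u 0 0 = P.
Proof.
destruct P as [x y]; unfold lattice_point, translate; simpl; f_equal; ring.
Qed.

Lemma lattice_point_axis (P u : point) (k : Z) :
  lattice_point P u k 0 = translate P (IZR k) u.
Proof. unfold lattice_point, translate; simpl; f_equal; ring. Qed.

Lemma lattice_point_move (P u : point) (i j k a b : Z) :
  lattice_point P u (i + k * a) (j + k * b) =
  translate (lattice_point P u i j) (IZR k) (lattice_vector u a b).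
Proof.
unfold lattice_point, lattice_vector, translate; simpl.
rewrite !plus_IZR, !mult_IZR; f_equal; ring.
Qed.

(** * Colourings of the plane and of a lattice *)

Definition spaced (c : point -> colour) (t : Z) : Prop :=
  forall P u, unit_vector u -> c P = red -> c (translate P (IZR t) u) = blue.

Definition dense (c : point -> colour) : Prop :=
  forall P u, unit_vector u ->
    exists k : nat, (k < 5)%nat /\ c (translate P (INR k) u) = red.

(** The lattice versions are purely combinatorial: all geometry is in
    [lattice_spaced] and [lattice_dense] below. *)
Definition zspaced (f : Z -> Z -> colour) (t : Z) : Prop :=
  forall i j a b, eisenstein_norm a b = 1%Z ->
    f i j = red -> f (i + t * a)%Z (j + t * b)%Z = blue.

Definition zdense (f : Z -> Z -> colour) : Prop :=
  forall i j a b, eisenstein_norm a b = 1%Z ->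
    f i j = red \/
    f (i + 1 * a)%Z (j + 1 * b)%Z = red \/
    f (i + 2 * a)%Z (j + 2 * b)%Z = red \/
    f (i + 3 * a)%Z (j + 3 * b)%Z = red \/
    f (i + 4 * a)%Z (j + 4 * b)%Z = red.

Lemma lattice_spaced (c : point -> colour) (t : Z) (P u : point) :
  unit_vector u -> spaced c t -> zspaced (fun i j => c (lattice_point P u i j)) t.
Proof.
intros Hu Hs i j a b Hab Hr.
rewrite lattice_point_move; apply Hs; [|exact Hr].
now apply unit_lattice_vector.
Qed.

Lemma lattice_dense (c : point -> colour) (P u : point) :
  unit_vector u -> dense c -> zdense (fun i j => c (lattice_point P u i j)).
Proof.
intros Hu Hd i j a b Hab.
destruct (Hd (lattice_point P u i j) (lattice_vector u a b)) as [k [Hk Hr]].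
  now apply unit_lattice_vector.
rewrite INR_IZR_INZ, <- lattice_point_move in Hr.
destruct k as [|[|[|[|[|k]]]]]; simpl Z.of_nat in Hr; [| tauto .. | lia].
left; now rewrite !Z.mul_0_l, !Z.add_0_r in Hr.
Qed.

(** * The Moser spindle *)

(** The rotation that moves every point at distance [sqrt 3] from the centre by
    distance 1: its cosine is [1 - 1/6]. *)
Definition moser (u : point) : point := turn (5 / 6) (sqrt 11 / 6) u.

Lemma unit_moser (u : point) : unit_vector u -> unit_vector (moser u).
Proof.
apply unit_vector_turn.
pose proof (sqrt_sqrt 11 ltac:(lra)) as H; lra.
Qed.

Lemma unit_moser_sub (u : point) (a b : Z) :
  unit_vector u -> eisenstein_norm a b = 3%Z ->
  unit_vector (translate (lattice_vector u a b) (-1)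
                         (lattice_vector (moser u) a b)).
Proof.
rewrite !unit_vector_sq; intros Hu Hab.
apply (f_equal IZR) in Hab; unfold eisenstein_norm in Hab.
rewrite !plus_IZR, !mult_IZR in Hab.
unfold lattice_vector, moser, sixth, turn, translate; simpl.
pose proof half_sqrt3_sq as Hs; set (s := sqrt 3 / 2) in *.
assert (Ht : (sqrt 11 / 6) * (sqrt 11 / 6) = 11 / 36)
  by (pose proof (sqrt_sqrt 11 ltac:(lra)); lra).
set (t := sqrt 11 / 6) in *.
set (x := IZR a) in *; set (y := IZR b) in *.
(* |(1 - r) z|^2 = |z|^2 |1 - r|^2 for the rotation r, and |1 - r|^2 = 1/3 *)
transitivity ((x * x + x * y + y * y * (1 / 4) + y * y * (s * s))
  * (fst u * fst u + snd u * snd u)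
  * ((1 - 5 / 6) * (1 - 5 / 6) + t * t)); [field|].
rewrite Hs, Ht, Hu.
replace (x * x + x * y + y * y * (1 / 4) + y * y * (3 / 4))
  with (x * x + x * y + y * y) by field.
rewrite Hab; field.
Qed.

(** [moser_point P u i j k l] is [P + (i + j w + k r + l w r) u] for the sixth
    root of unity [w] and the Moser rotation [r]. *)
Definition moser_point (P u : point) (i j k l : Z) : point :=
  lattice_point (lattice_point P u i j) (moser u) k l.

Lemma moser_point_move (P u : point) (i j k l a b : Z) :
  moser_point P u (i + a) (j + b) (k - a) (l - b) =
  translate (moser_point P u i j k l) 1
    (translate (lattice_vector u a b) (-1) (lattice_vector (moser u) a b)).
Proof.
unfold moser_point, lattice_point, lattice_vector, translate; simpl.
rewrite !minus_IZR, !plus_IZR; f_equal; ring.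
Qed.

Lemma spaced_moser (c : point -> colour) (P u : point) (i j k l a b : Z) :
  spaced c 1 -> unit_vector u -> eisenstein_norm a b = 3%Z ->
  c (moser_point P u i j k l) = red ->
  c (moser_point P u (i + a) (j + b) (k - a) (l - b)) = blue.
Proof.
intros S Hu Hab Hr; rewrite moser_point_move.
apply S; [now apply unit_moser_sub | exact Hr].
Qed.

(** * Forced colours in one triangular lattice *)

Local Open Scope Z_scope.

(** [forbid H S a b]: the red point of [H] makes blue the point at [t] times
    the unit lattice vector [(a, b)] from it, where [S : zspaced f t]. *)
Ltac forbid H S a b :=
  let B := fresh "B" in
  pose proof (S _ _ a b eq_refl H) as B; cbn in B.

(** [find_red D i j a b H]: case analysis on the red point [H] of the five
    points from [(i, j)] in direction [(a, b)], discarding known blue ones. *)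
Ltac find_red D i j a b H :=
  destruct (D i j a b eq_refl) as [H|[H|[H|[H|H]]]];
  cbn in H; try congruence.

(** [(1, 1)] and [(2, -1)] are the middles of the five lattice points on the two
    lines next to the segment: the unit circles around its ends contain the
    other four. *)
Lemma lattice_three (f : Z -> Z -> colour) :
  zspaced f 1 -> zdense f ->
  f 0 0 = red -> f 3 0 = red ->
  f 1 1 = red /\ f 2 (-1) = red.
Proof.
intros S D A E.
split.
- forbid A S (-1) 1; forbid A S 0 1; forbid E S (-1) 1; forbid E S 0 1.
  find_red D (-1) 1 1 0 H; assumption.
- forbid A S 0 (-1); forbid A S 1 (-1); forbid E S 0 (-1); forbid E S 1 (-1).
  find_red D 0 (-1) 1 0 H; assumption.
Qed.

(** The lines on both sides of the segment force [(-1, -1)] and [(3, 1)] to be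
    red; together with the two given points they make a line through the
    midpoint [(1, 0)] entirely blue. *)
Lemma lattice_two (f : Z -> Z -> colour) :
  zspaced f 1 -> zspaced f 3 -> zdense f ->
  f 0 0 = red -> f 2 0 = blue.
Proof.
intros S1 S3 D A.
destruct (f 2 0) eqn:E; [exfalso | reflexivity].
forbid A S1 0 (-1); forbid A S1 1 (-1); forbid A S1 1 0.
forbid A S1 (-1) 1; forbid A S1 0 1.
forbid E S1 0 (-1); forbid E S1 1 (-1); forbid E S1 (-1) 1; forbid E S1 0 1.
find_red D (-1) (-1) 1 0 F.
find_red D (-1) 1 1 0 G.
forbid F S3 0 1; forbid G S3 0 (-1).
find_red D 3 (-2) (-1) 1 H.
Qed.

(** Four lines have only two candidates for a red point each.  If [(1, 1)] is
    red, then so are [(2, -1)] and [(-1, 2)], at distance 3; if it is blue, then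
    the neighbours [(2, 1)] and [(1, 2)] are both red. *)
Lemma lattice_four (f : Z -> Z -> colour) :
  zspaced f 1 -> zspaced f 2 -> zspaced f 3 -> zdense f ->
  f 0 0 = red -> f 4 0 = blue.
Proof.
intros S1 S2 S3 D A.
destruct (f 4 0) eqn:E; [exfalso | reflexivity].
forbid A S1 1 0; forbid A S1 1 (-1); forbid A S1 (-1) 1; forbid A S1 0 1.
forbid A S2 1 0; forbid A S2 1 (-1); forbid A S2 (-1) 1; forbid A S2 0 1.
forbid E S1 (-1) 1; forbid E S2 (-1) 1; forbid E S3 (-1) 1.
destruct (f 1 1) eqn:F.
- forbid F S1 1 0; forbid F S1 0 1.
  find_red D 2 (-2) 0 1 G.
  find_red D (-2) 2 1 0 H.
  forbid G S3 (-1) 1; congruence.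
- find_red D 1 (-1) 0 1 G.
  find_red D (-1) 1 1 0 H.
  forbid G S1 1 (-1); congruence.
Qed.

(** * The distances 3, 2 and 4 *)

(** With [A = P] and [E = P + 3u], the points [B] and [C] are the two lattice
    points on the perpendicular bisector at distance [sqrt 3] from [A] and [E].
    The turned lines are not themselves in the lattice of [P] and [u], but each
    is in a lattice through [B] or [C]. *)
Lemma spaced_three (c : point -> colour) :
  spaced c 1 -> dense c -> spaced c 3.
Proof.
intros S D P u Hu A.
destruct (c (translate P 3%R u)) eqn:E; [exfalso | reflexivity].
pose proof (unit_moser u Hu) as Hv.
rewrite <- lattice_point_axis in E.
rewrite <- (lattice_point_origin P u) in A.
destruct (lattice_three _ (lattice_spaced c 1 P u Hu S)
            (lattice_dense c P u Hu D) A E) as [B C].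
pose proof (fun i j => lattice_spaced c 1 (lattice_point P u i j) _ Hv S) as Sv.
pose proof (fun i j => lattice_dense c (lattice_point P u i j) _ Hv D) as Dv.
pose proof (fun i j k l a b => spaced_moser c P u i j k l a b S Hu) as M.
assert (O : forall i j, c (lattice_point P u i j) = red ->
                        c (moser_point P u i j 0 0) = red)
  by (intros i j H; unfold moser_point; now rewrite lattice_point_origin).
apply O in A, B, C, E; clear O.
unfold moser_point in *.
(* the turned unit line next to B: its fifth point X is red *)
forbid B (Sv 1 1) 0 (-1); forbid B (Sv 1 1) 1 (-1).
pose proof (M _ _ _ _ 1 1 eq_refl A) as A1; cbn in A1.
pose proof (M _ _ _ _ (-2) 1 eq_refl E) as E1; cbn in E1.
find_red (Dv 1 1) (-2) (-1) 1 0 X.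
(* the turned unit line next to C: its fifth point Y is red *)
forbid C (Sv 2 (-1)) 0 1; forbid C (Sv 2 (-1)) (-1) 1.
pose proof (M _ _ _ _ 2 (-1) eq_refl A) as A2; cbn in A2.
pose proof (M _ _ _ _ (-1) (-1) eq_refl E) as E2; cbn in E2.
find_red (Dv 2 (-1)) (-3) 1 1 0 Y.
(* X and Y differ by a lattice vector of norm 3 minus its rotation *)
pose proof (M _ _ _ _ 1 (-2) eq_refl X) as XY; cbn in XY.
congruence.
Qed.

Lemma spaced_two (c : point -> colour) :
  spaced c 1 -> spaced c 3 -> dense c -> spaced c 2.
Proof.
intros S1 S3 D P u Hu A.
rewrite <- (lattice_point_origin P u) in A.
rewrite <- lattice_point_axis.
now apply (lattice_two (fun i j => c (lattice_point P u i j)));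
  [apply lattice_spaced .. | apply lattice_dense |].
Qed.

Lemma spaced_four (c : point -> colour) :
  spaced c 1 -> spaced c 2 -> spaced c 3 -> dense c -> spaced c 4.
Proof.
intros S1 S2 S3 D P u Hu A.
rewrite <- (lattice_point_origin P u) in A.
rewrite <- lattice_point_axis.
now apply (lattice_four (fun i j => c (lattice_point P u i j)));
  [apply lattice_spaced .. | apply lattice_dense |].
Qed.

Local Close Scope Z_scope.

(** * The circle of radius 5 *)

Lemma red_circle (c : point -> colour) :
  spaced c 1 -> dense c ->
  forall P u, unit_vector u -> c P = red -> c (translate P 5 u) = red.
Proof.
intros S1 D P u Hu A.
pose proof (spaced_three c S1 D) as S3.
pose proof (spaced_two c S1 S3 D) as S2.
pose proof (spaced_four c S1 S2 S3 D) as S4.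
destruct (D (translate P 1 u) u Hu) as [k [Hk H]].
replace (translate (translate P 1 u) (INR k) u)
  with (translate P (INR (S k)) u) in H
  by (rewrite S_INR; unfold translate; simpl; f_equal; ring).
rewrite INR_IZR_INZ in H.
pose proof (S1 P u Hu A); pose proof (S2 P u Hu A).
pose proof (S3 P u Hu A); pose proof (S4 P u Hu A).
destruct k as [|[|[|[|[|k]]]]]; simpl Z.of_nat in H;
  [congruence .. | exact H | lia].
Qed.

Lemma not_spaced_dense (c : point -> colour) : spaced c 1 -> ~ dense c.
Proof.
intros S D.
assert (Hu : unit_vector (1, 0)) by (apply unit_vector_sq; simpl; ring).
assert (Hs : sqrt 99 * sqrt 99 = 99) by (apply sqrt_sqrt; lra).
destruct (D (0, 0) (1, 0) Hu) as [k [_ A]].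
(* unit vectors whose ends are 1/5 apart *)
set (v := (49 / 50, sqrt 99 / 50)).
assert (Hv : unit_vector v) by (apply unit_vector_sq; simpl; lra).
assert (Hw : unit_vector (5 * (49 / 50) - 5, 5 * (sqrt 99 / 50)))
  by (apply unit_vector_sq; simpl; lra).
pose proof (red_circle c S D _ _ Hu A) as H1.
pose proof (red_circle c S D _ _ Hv A) as H2.
pose proof (S _ _ Hw H1) as H3.
enough (E : forall P, translate (translate P 5 (1, 0)) 1
            (5 * (49 / 50) - 5, 5 * (sqrt 99 / 50)) = translate P 5 v)
  by (rewrite E in H3; congruence).
intros P; unfold translate, v; simpl; f_equal; ring.
Qed.

Theorem theorem1p1 (c : point -> colour)
  (hred : ~ exists A B : point, c A = red /\ c B = red /\ edist A B = 1) :
  exists X : point -> Prop,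
    forms_ell 5 X /\ forall Q : point, X Q -> c Q = blue.
Proof.
apply NNPP; intros Hno.
apply (not_spaced_dense c).
- intros P u Hu A.
  destruct (c (translate P 1 u)) eqn:E; [exfalso | reflexivity].
  apply hred; exists P, (translate P 1 u).
  now repeat split; try apply edist_translate.
- intros P u Hu; apply NNPP; intros Hblue.
  apply Hno.
  exists (fun Q => exists k : nat, (k < 5)%nat /\ Q = translate P (INR k) u).
  split.
  + exists P, u; split; [exact Hu | now intros Q].
  + intros Q [k [Hk ->]].
    destruct (c (translate P (INR k) u)) eqn:E; [exfalso | reflexivity].
    apply Hblue; now exists k.
Qed.
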